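(* Let $g\ge3$, $2\le k<g$ and $m\ge2$ be integers. Suppose that there are exactly $m-1$ distinct integers $r$ such that $$a=r\,\frac{kg-1}{k^2-1}<g\quad\text{and}\quad b=r\,\frac{g-k}{k^2-1}$$ are positive integers, and suppose that the $(g,k)$ Young graph is the complete graph $K_m$. Let $r_0$ be the smallest of these $m-1$ values of $r$. Then: (i) The non-starting nodes of the Young graph are $[ir_0,ir_0]$, $0\le i\le m-1$, and the edge from the starting node (for $1\le i\le m-1$), and from the node $[0,0]$, to $[ir_0,ir_0]$ has label $\bigl(ir_0(g-k)/(k^2-1),\ ir_0(kg-1)/(k^2-1)\bigr)$. (ii) The generating function of the $(g,k)$-reverse multiples is $$\mathcal C(x)=\frac{(m-1)x^2(1+x)}{1-mx^2}=(m-1)\bigl(x^2+x^3+mx^4+mx^5+m^2x^6+m^2x^7+\cdots\bigr).$$ (iii) The $(g,k)$-reverse multiples are exactly the numbers $\gamma\beta$, where $\gamma=\bigl(r_0(g-k)/(k^2-1),\ r_0(kg-1)/(k^2-1)\bigr)_g$ (a two-digit base-$g$ number) and $\beta$ ranges over all positive integers whose base-$g$ expansion is palindromic and uses only the digits $0,1,\dots,m-1$.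
   Context: Notation: $(a_{n-1},\dots,a_1,a_0)_g$ denotes $\sum_{i=0}^{n-1}a_ig^i$ with digits $0\le a_i<g$; if $a_{n-1}\ne0$ it has length $n$. A positive integer $N=(a_{n-1},\dots,a_0)_g$ with $a_{n-1}\neq 0$ is a $(g,k)$-reverse multiple if $kN=(a_0,a_1,\dots,a_{n-1})_g$. Let $c_t$ be the number of $(g,k)$-reverse multiples of length $t$ and $\mathcal C(x)=\sum_{t\ge0}c_tx^t$. Young graph. The directed edge-labelled graph $H(g,k)$ is defined as follows. Its possible nodes are a distinguished starting node, written $[[0,0]]$, and ordered pairs $[s,r]$ of integers with $0\le s,r\le k-1$ (the pair $[0,0]$ is a node distinct from the starting node). For a node $[s,r]$ (the starting node being treated as $s=r=0$) and each pair of digits $(c,a)$, $0\le a,c\le g-1$, with $ka+r\equiv c \pmod g$ and $0\le a+sg-kc\le k-1$, there is a directed edge labelled $(c,a)$ from $[s,r]$ to the node $[\,a+sg-kc,\ (ka+r-c)/g\,]$; for edges leaving the starting node one additionally requires $a\ne0$ and $c\ne0$. $H(g,k)$ consists of the starting node, the nodes reachable from it by directed paths, and all edges leaving these nodes. A non-starting node of the form $[r,r]$ ($r\ge0$, including $[0,0]$) is an even pivot node; a non-starting node is an odd pivot node if it is of the form $[r,r]$ and carries a loop, or is of the form $[r',r]$ with $r'\ne r$ and has an edge to $[r,r']$. The $(g,k)$ Young graph exists if $H(g,k)$ contains a node $[r,r]$ with $r\ne0$ or an edge $[r',r]\to[r,r']$ with $r'\ne r$; it is then obtained from $H(g,k)$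 by deleting every node from which no pivot node can be reached by a directed path, together with all edges incident to such nodes. Complete graph $K_m$: a Young graph is the complete graph $K_m$ if it has exactly $m$ non-starting nodes, there is a directed edge from every non-starting node to every non-starting node (including a loop at each non-starting node), and the starting node has an edge to every non-starting node except $[0,0]$. *)

(* Defs.v *)
From mathcomp Require Import all_boot all_order all_algebra.
From Stdlib Require Import Relation_Operators.

Set Implicit Arguments.
Unset Strict Implicit.
Unset Printing Implicit Defensive.

Import Order.TTheory GRing.Theory Num.Theory.
Local Open Scope ring_scope.

Definition exactly (T : eqType) (n : nat) (P : T -> Prop) : Prop :=
  exists s : seq T, [/\ uniq s, size s = n & forall x, x \in s <-> P x].

(* Digit lists are written most significant digit first, so that
   [:: a_(n-1); ...; a_0] has value (a_(n-1), ..., a_0)_g. *)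
Definition numeral (g : nat) (ds : seq nat) : nat :=
  (\sum_(i < size ds) nth 0 (rev ds) i * g ^ i)%N.

(* The condition on the head also rejects the empty list. *)
Definition is_expansion (g : nat) (ds : seq nat) (N : nat) : bool :=
  [&& all (fun d => d < g)%N ds, head 0%N ds != 0%N & N == numeral g ds].

Definition revmul_len (g k t N : nat) : bool :=
  (0 < N)%N &&
  [exists a : t.-tuple 'I_g, let ds := [seq val d | d <- a] in
     is_expansion g ds N && (k * N == numeral g (rev ds))%N].

Definition revmul (g k N : nat) : Prop := exists t, revmul_len g k t N.

(* A number of length t is smaller than g ^ t. *)
Definition count_revmul (g k t : nat) : nat :=
  #|[set N : 'I_(g ^ t) | revmul_len g k t N]|.

Definition palindrome_below (g m N : nat) : Prop :=
  exists ds : seq nat,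
    [/\ is_expansion g ds N, rev ds = ds & all (fun d => d < m)%N ds].

(* Formal power series over the integers are coefficient sequences. *)
Definition series := nat -> int.

Definition poly_series (p : {poly int}) : series := fun n => p`_n.

Definition mul_series (f h : series) : series :=
  fun n => \sum_(i < n.+1) f i * h (n - i)%N.

(* f = p / q in Z[[x]]: q is invertible there iff q`_0 is a unit. *)
Definition series_is_frac (f : series) (p q : {poly int}) : Prop :=
  q`_0 \is a GRing.unit /\ mul_series (poly_series q) f =1 poly_series p.

Definition revmul_gf (g k : nat) : series := fun t => (count_revmul g k t)%:Z.

Definition digit_a (g k : nat) (r : int) : rat :=
  r%:~R * ((k%:R * g%:R - 1) / (k%:R ^+ 2 - 1)).

Definition digit_b (g k : nat) (r : int) : rat :=
  r%:~R * ((g%:R - k%:R) / (k%:R ^+ 2 - 1)).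

Definition admissible (g k : nat) (r : int) : Prop :=
  [/\ digit_a g k r \is a Num.int, 0 < digit_a g k r, digit_a g k r < g%:R,
      digit_b g k r \is a Num.int & 0 < digit_b g k r].

Inductive node := Start | Pair of int & int.

Definition possible (k : nat) (u : node) : bool :=
  if u is Pair s r then (0 <= s <= k%:Z - 1) && (0 <= r <= k%:Z - 1) else true.

Definition coords (u : node) : int * int :=
  if u is Pair s r then (s, r) else (0, 0).

Definition edge (g k : nat) (u : node) (c a : int) (v : node) : Prop :=
  let: (s, r) := coords u in
  let s' := a + s * g%:Z - k%:Z * c in
  let r' := ((k%:Z * a + r - c) %/ g%:Z)%Z in
  [/\ possible k u,
      (0 <= a <= g%:Z - 1) && (0 <= c <= g%:Z - 1),
      (k%:Z * a + r = c %[mod g%:Z])%Z /\ 0 <= s' <= k%:Z - 1,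
      u = Start -> a <> 0 /\ c <> 0
    & v = Pair s' r'].

Definition arrow (g k : nat) (u v : node) : Prop :=
  exists c a, edge g k u c a v.

Definition reach (g k : nat) : node -> node -> Prop :=
  clos_refl_trans node (arrow g k).

Definition H_node (g k : nat) (u : node) : Prop := reach g k Start u.

Definition H_arrow (g k : nat) (u v : node) : Prop :=
  H_node g k u /\ arrow g k u v.

Definition even_pivot (g k : nat) (u : node) : Prop :=
  H_node g k u /\ exists r, u = Pair r r.

Definition odd_pivot (g k : nat) (u : node) : Prop :=
  (exists r, u = Pair r r /\ H_arrow g k u u) \/
  (exists r' r, [/\ r' <> r, u = Pair r' r & H_arrow g k u (Pair r r')]).

Definition pivot (g k : nat) (u : node) : Prop :=
  even_pivot g k u \/ odd_pivot g k u.

Definition young_exists (g k : nat) : Prop :=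
  (exists r, r <> 0 /\ H_node g k (Pair r r)) \/
  (exists r' r, r' <> r /\ H_arrow g k (Pair r' r) (Pair r r')).

(* A path from a node of H stays in H, and pivots reach themselves by the
   empty path. *)
Definition young_node (g k : nat) (u : node) : Prop :=
  H_node g k u /\ exists p, pivot g k p /\ reach g k u p.

Definition young_edge (g k : nat) (u : node) (c a : int) (v : node) : Prop :=
  [/\ young_node g k u, young_node g k v & edge g k u c a v].

Definition young_arrow (g k : nat) (u v : node) : Prop :=
  exists c a, young_edge g k u c a v.

Definition young_is_complete (g k m : nat) : Prop :=
  [/\ young_exists g k,
      exactly m (fun p : int * int => young_node g k (Pair p.1 p.2)),
      forall s r s' r', young_node g k (Pair s r) ->
        young_node g k (Pair s' r') -> young_arrow g k (Pair s r) (Pair s' r')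
    & forall s r, young_node g k (Pair s r) -> (s, r) <> (0, 0) ->
        young_arrow g k Start (Pair s r)].

(* The Young graph has exactly one edge from u to v, and its label is (x, y). *)
Definition the_edge_label (g k : nat) (u v : node) (x y : rat) : Prop :=
  exists c a : int, [/\ c%:~R = x, a%:~R = y
    & forall c' a', young_edge g k u c' a' v <-> c' = c /\ a' = a].

(* Main.v *)
Require Import Defs.
From mathcomp Require Import all_boot all_order all_algebra zify ring lra.
From Stdlib Require Import Relation_Operators.
Import Order.TTheory GRing.Theory Num.Theory.
Local Open Scope ring_scope.

(** In the coordinates [s, r], an edge [s, r] -> [s', r'] labelled (c, a) is a
    solution of the linear system a + s g = k c + s', k a + r = c + g r'.  The
    diagonal nodes joined to Start are thus the admissible r; the solutions
    form a lattice, so the admissible r are the first m - 1 positive multiples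
    of r0.  The graph is invariant under reversing all edges while swapping
    coordinates, so if the one remaining node of K_m were off the diagonal its
    swap would be a further node; hence it is [0, 0].

    The carries e_i r0 of the multiplication of a reverse multiple N by k trace
    a path from Start to [0, 0] in the Young graph, hence are palindromic, and
    the i-th digit of N is e_(i+1) a + e_i b.  This says that
    N = (b g + a) * (e_(n-1), ..., e_1)_g.  Conversely, the loop at
    [(m-1) r0, (m-1) r0] gives (m - 1) (a + b) < g, so multiplying a palindrome
    with digits below m by b g + a involves no carry. *)

Set Implicit Arguments.
Unset Strict Implicit.

(** * Base-[g] digit lists and carries *)

Section Numerals.
Local Open Scope nat_scope.
Variable g : nat.

(** Reads the list from its least significant digit, opposite to [numeral], so that recursion on
    lists follows the carries. *)
Definition lsd_value (l : seq nat) : nat := \sum_(i < size l) nth 0 l i * g ^ i.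

Lemma numeral_rev l : numeral g (rev l) = lsd_value l.
Proof. by rewrite /numeral revK size_rev. Qed.

Lemma numeralE l : numeral g l = lsd_value (rev l).
Proof. by rewrite -numeral_rev revK. Qed.

Lemma lsd_value_cons x l : lsd_value (x :: l) = x + g * lsd_value l.
Proof.
rewrite /lsd_value /= big_ord_recl /= muln1 big_distrr /=; congr (_ + _).
by apply: eq_bigr => i _; rewrite /bump /= add1n expnS mulnCA.
Qed.

Lemma lsd_value_inj l l' : size l = size l' ->
  all (fun d => d < g) l -> all (fun d => d < g) l' ->
  lsd_value l = lsd_value l' -> l = l'.
Proof.
elim: l l' => [|x l IH] [|y l'] //= [es] /andP [xg lg] /andP [yg l'g].
rewrite !lsd_value_cons => e.
have exy : x = y.
  move: (congr1 (modn^~ g) e).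
  by rewrite !(mulnC g) !(addnC _ (_ * g)) !modnMDl !modn_small.
by rewrite exy (IH l') //; nia.
Qed.

Lemma lsd_value_lt l : all (fun d => d < g) l -> lsd_value l < g ^ size l.
Proof.
elim: l => [|x l IH] /=; first by rewrite /lsd_value big_ord0.
by case/andP=> xg /IH h; rewrite lsd_value_cons expnS; nia.
Qed.

Lemma lsd_value_gt0 l : 0 < g -> last 0 l != 0 -> 0 < lsd_value l.
Proof.
move=> g0; elim: l => [|x l IH] //=; rewrite lsd_value_cons.
by case: l IH => [|y l] IH /= h; [lia | have := IH h; nia].
Qed.

Lemma expansion_gt0 ds N : 0 < g -> is_expansion g ds N -> 0 < N.
Proof.
move=> g0 /and3P [_ h /eqP ->]; rewrite numeralE lsd_value_gt0 //.
by case: ds h => //= x ds; rewrite rev_cons last_rcons.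
Qed.

Lemma revmul_lenP k t N : 0 < g -> revmul_len g k t N <->
  exists ds, [/\ size ds = t, is_expansion g ds N
               & k * N = numeral g (rev ds)].
Proof.
move=> g0; rewrite /revmul_len; split.
  case/andP=> _ /existsP [a /andP [h /eqP e]].
  by exists [seq val d | d <- a]; rewrite size_map size_tuple.
case=> ds [sds hds e]; rewrite (expansion_gt0 g0 hds) /=.
have dg (i : 'I_t) : nth 0 ds i < g.
  by case/and3P: hds => /all_nthP h _ _; apply: h; rewrite sds.
apply/existsP; exists (mktuple (fun i => Ordinal (dg i))).
have -> : [seq val d | d <- mktuple (fun i => Ordinal (dg i))] = ds.
  rewrite /= -map_comp /= -[RHS](mkseq_nth 0) sds /mkseq -val_enum_ord -map_comp.
  exact: eq_map.
by rewrite hds e eqxx.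
Qed.

(* The digits of (b g + a) * beta, least significant first, where l lists the
   digits of beta and no carry is propagated. *)
Definition scaled_digits (a b : nat) (l : seq nat) : seq nat :=
  mkseq (fun i => nth 0 l i * a + nth 0 (0 :: l) i * b) (size l).+1.

Lemma size_scaled_digits a b l : size (scaled_digits a b l) = (size l).+1.
Proof. exact: size_mkseq. Qed.

Lemma lsd_value_scaled a b l :
  lsd_value (scaled_digits a b l) = (b * g + a) * lsd_value l.
Proof.
rewrite /lsd_value size_scaled_digits.
transitivity (\sum_(i < (size l).+1) nth 0 l i * g ^ i * a +
              \sum_(i < (size l).+1) nth 0 (0 :: l) i * g ^ i * b).
  rewrite -big_split /=; apply: eq_bigr => i _.
  by rewrite nth_mkseq //; ring.
(* The first sum loses its top term, a default digit past the end of [l]; the second loses the 0 put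
   in front and is thereby shifted by one power of [g]. *)
rewrite big_ord_recr /= nth_default // mul0n mul0n addn0.
rewrite [X in _ + X]big_ord_recl /= !mul0n add0n -!big_distrl /=.
rewrite [X in _ + X * b](eq_bigr (fun i : 'I_(size l) => (nth 0 l i * g ^ i) * g)); last first.
  by move=> i _; rewrite /bump /= add1n expnS; ring.
by rewrite -big_distrl /=; ring.
Qed.

(** For a palindromic [l] of value [beta], reversal thus gives [(a g + b) beta], and the digit
    equations yield [a g + b = k (b g + a)]. *)
Lemma rev_scaled_digits a b l :
  rev (scaled_digits a b l) = scaled_digits b a (rev l).
Proof.
apply: (@eq_from_nth _ 0); rewrite size_rev !size_scaled_digits ?size_rev // => i hi.
rewrite nth_rev ?size_scaled_digits // !nth_mkseq ?size_rev //; last by lia.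
rewrite addnC subSS; congr (_ + _).
  have [il|il] := ltnP i (size l).
    by rewrite nth_rev // -[size l - i]prednK /=; [congr (nth _ _ _ * _); lia|lia].
  have -> : size l - i = 0 by lia.
  by rewrite [nth _ (rev l) _]nth_default ?size_rev.
case: i hi => [|i] hi /=; first by rewrite subn0 nth_default.
by rewrite nth_rev.
Qed.

Lemma last_scaled_digits a b l :
  last 0 (scaled_digits a b l) = last 0 l * b.
Proof.
rewrite -nth_last size_scaled_digits nth_mkseq //= nth_default // mul0n add0n.
by case: (lastP l) => //= l' x; rewrite size_rcons last_rcons -rcons_cons nth_rcons /= ltnn eqxx.
Qed.

Lemma scaled_digits_bound a b m l :
  all (fun d => d < m) l -> (m - 1) * (a + b) < g ->
  all (fun d => d < g) (scaled_digits a b l).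
Proof.
move=> lm mg; apply/allP => x /mapP [i _ ->].
have nm j : nth 0 l j <= m - 1.
  have [jl|jl] := ltnP j (size l); last by rewrite nth_default.
  by move/all_nthP: lm => /(_ 0 j jl); lia.
have h1 := nm i.
have h2 : nth 0 (0 :: l) i <= m - 1 by case: i {h1} => [|i] //=.
by nia.
Qed.

(** The carry entering position [i]: index 0 gives the initial carry, and indices past the end
    repeat the final one. *)
Fixpoint carry (k r : nat) (l : seq nat) (i : nat) : nat :=
  match i, l with
  | i'.+1, x :: l' => carry k ((k * x + r) %/ g) l' i'
  | _, _ => r
  end.

Lemma carry_lt k r l i : r < k -> all (fun d => d < g) l -> carry k r l i < k.
Proof.
elim: l r i => [|x l IH] r [|i] //= rk /andP [xg lg].
by apply: IH => //; rewrite ltn_divLR; nia.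
Qed.

(** Modulo [g] the equation identifies the first digit of [l'] with the low digit of [k x + r];
    cancelling it and dividing by [g] leaves the same equation for the tails. The overflow beyond
    the top digit is [z]. *)
Lemma carryP k r l l' z : size l = size l' -> all (fun d => d < g) l' ->
  k * lsd_value l + r = lsd_value l' + g ^ size l * z ->
  carry k r l (size l) = z /\
  forall i, i < size l ->
    k * nth 0 l i + carry k r l i = nth 0 l' i + g * carry k r l i.+1.
Proof.
elim: l l' r => [|x l IH] [|y l'] r //=.
  by rewrite /lsd_value !big_ord0 => _ _; rewrite muln0 mul1n !add0n.
move=> [es] /andP [yg l'g]; rewrite !lsd_value_cons expnS => e.
have e1 : k * x + r = (k * x + r) %/ g * g + y.
  rewrite [LHS](divn_eq _ g); congr (_ + _).
  have := congr1 (modn^~ g) e.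
  have -> : k * (x + g * lsd_value l) + r = k * lsd_value l * g + (k * x + r) by ring.
  have -> : y + g * lsd_value l' + g * g ^ size l * z =
    (lsd_value l' + g ^ size l * z) * g + y by ring.
  by rewrite !modnMDl => ->; rewrite modn_small.
have [] := IH l' ((k * x + r) %/ g) es l'g; first by nia.
move=> h1 h2; split=> // -[|i] /=; last exact: h2.
by case: (l) => /=; lia.
Qed.

End Numerals.
Lemma head_rev (T : Type) (x : T) s : head x (rev s) = last x s.
Proof. by case: (lastP s) => // s' y; rewrite rev_rcons last_rcons. Qed.

(** * Edges of the Young graph as solutions of a linear system *)

Section YoungGraph.
Variables g k : nat.
Hypotheses (k_ge2 : (2 <= k)%N) (k_lt_g : (k < g)%N).

Lemma edgeP s r c a s' r' :
  edge g k (Pair s r) c a (Pair s' r') <->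
  [/\ possible k (Pair s r), possible k (Pair s' r'),
      (0 <= a < g%:Z) && (0 <= c < g%:Z),
      a + s * g%:Z = k%:Z * c + s' & k%:Z * a + r = c + g%:Z * r'].
Proof.
rewrite /edge /=; split.
  case=> hu hac [/eqP hmod hs'] _ [es er].
  move: hmod; rewrite eqz_mod_dvd => /dvdzP [q hq].
  have g0 : g%:Z != 0 by lia.
  move: er; rewrite hq mulzK // => er; subst q.
  split; [by lia | | by lia | by lia | by lia].
  (* [edge] bounds only the first coordinate of its target; the second is in range because
     [g r' = k a + r - c] lies strictly between [- g] and [k g]. *)
  by apply/andP; split; [lia | nia].
case=> hu hv hac e1 e2; split=> //.
- by lia.
- split; last by lia.
  by apply/eqP; rewrite eqz_mod_dvd; apply/dvdzP; exists r'; lia.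
- congr Pair; first by lia.
  have -> : k%:Z * a + r - c = r' * g%:Z by lia.
  by rewrite mulzK //; lia.
Qed.

Lemma edge_StartP c a v :
  edge g k Start c a v <-> [/\ edge g k (Pair 0 0) c a v, a <> 0 & c <> 0].
Proof.
rewrite /edge /=; split.
  by case=> _ h1 h2 h3 h4; have [] := h3 erefl; split=> //; split=> //; lia.
by case=> [[h1 h2 h3 h4 h5] h6 h7]; split.
Qed.

(** The substitution merely exchanges the two linear equations of [edgeP]. *)
Lemma edge_rev s r c a s' r' :
  edge g k (Pair s r) c a (Pair s' r') -> edge g k (Pair r' s') a c (Pair r s).
Proof.
case/edgeP=> /= h1 h2 h3 e1 e2; apply/edgeP; split=> /=; lia.
Qed.

(** The equations of an edge [[0, 0] -> [r, r]] labelled [(b, a)], stripped of all bounds so that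
    the solutions are closed under integer combinations. *)
Definition digits_of (r a b : int) : Prop :=
  a = k%:Z * b + r /\ k%:Z * a = b + r * g%:Z.

(** Elimination in a two-by-two system whose determinant [k ^ 2 - 1] is nonzero. *)
Lemma digits_of_eq r a b :
  digits_of r a b <->
    (k%:Z ^+ 2 - 1) * a = r * (k%:Z * g%:Z - 1) /\
    (k%:Z ^+ 2 - 1) * b = r * (g%:Z - k%:Z).
Proof.
split.
  case=> h1 h2.
  have e1 : a - (k%:Z * b + r) = 0 by rewrite h1 subrr.
  have e2 : k%:Z * a - (b + r * g%:Z) = 0 by rewrite h2 subrr.
  split; apply/eqP; rewrite -subr_eq0; apply/eqP.
    transitivity (k%:Z * (k%:Z * a - (b + r * g%:Z)) - (a - (k%:Z * b + r))); first by ring.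
    by rewrite e1 e2; ring.
  transitivity ((k%:Z * a - (b + r * g%:Z)) - k%:Z * (a - (k%:Z * b + r))); first by ring.
  by rewrite e1 e2; ring.
case=> h1 h2.
have D0 : k%:Z ^+ 2 - 1 != 0 by nia.
split; apply: (mulfI D0).
  have -> : (k%:Z ^+ 2 - 1) * (k%:Z * b + r) =
    k%:Z * ((k%:Z ^+ 2 - 1) * b) + (k%:Z ^+ 2 - 1) * r by ring.
  by rewrite h1 h2; ring.
have -> : (k%:Z ^+ 2 - 1) * (k%:Z * a) = k%:Z * ((k%:Z ^+ 2 - 1) * a) by ring.
by rewrite mulrDr h1 h2; ring.
Qed.

Lemma digits_of_inj r a b a' b' :
  digits_of r a b -> digits_of r a' b' -> a = a' /\ b = b'.
Proof.
move=> /digits_of_eq [h1 h2] /digits_of_eq [h3 h4].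
have D0 : k%:Z ^+ 2 - 1 != 0 by nia.
by split; apply: (mulfI D0); rewrite ?h1 ?h2 ?h3 ?h4.
Qed.

Lemma sqrk1_neq0 : k%:R ^+ 2 - 1 != 0 :> rat.
Proof.
have : 2 <= k%:R :> rat by rewrite (ler_nat _ 2).
by move=> h; apply/eqP => e; nra.
Qed.

Lemma digits_ofP r a b :
  digits_of r a b <-> digit_a g k r = a%:~R /\ digit_b g k r = b%:~R.
Proof.
have D0 := sqrk1_neq0.
have ek : (k%:Z)%:~R = k%:R :> rat by [].
have eg : (g%:Z)%:~R = g%:R :> rat by [].
rewrite digits_of_eq /digit_a /digit_b !mulrA; split.
  case=> /(congr1 (intr : int -> rat)) h1 /(congr1 (intr : int -> rat)) h2.
  move: h1 h2; rewrite !rmorphM !rmorphB rmorphXn /= !rmorphM /= !rmorph1 ek eg => h1 h2.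
  by split; apply: (mulIf D0); rewrite divfK // -?h1 -?h2 mulrC.
case=> h1 h2.
split; apply: (@intr_inj rat);
  rewrite !rmorphM !rmorphB rmorphXn /= ?rmorphM /= ?rmorph1 ek eg.
  by rewrite -h1 mulrC divfK.
by rewrite -h2 mulrC divfK.
Qed.

Lemma admissibleP r :
  admissible g k r <->
  exists a b, [/\ digits_of r a b, 0 < a < g%:Z & 0 < b].
Proof.
rewrite /admissible; split.
  case=> /intrP [a ha]; rewrite ha => a0 ag /intrP [b hb]; rewrite hb => b0.
  exists a, b; split; first by apply/digits_ofP.
    by rewrite -(ltr0z rat) a0 -(ltr_int rat).
  by rewrite -(ltr0z rat).
case=> a [b [/digits_ofP [-> ->] /andP [a0 ag] b0]].
by split; rewrite ?intr_int ?ltr0z // -(ltr_int rat) in ag *.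
Qed.

Lemma digits_of_range r a b :
  digits_of r a b -> a < g%:Z -> 0 < b -> [/\ 0 < r, r < k%:Z & b < a].
Proof.
move=> h ag b0; have /digits_of_eq [_ h3] := h; case: h => h1 h2.
have D0 : 0 < k%:Z ^+ 2 - 1 by nia.
have gk : 0 < g%:Z - k%:Z by lia.
have r0 : 0 < r by rewrite -(pmulr_lgt0 _ gk) -h3 mulr_gt0.
by split=> //; nia.
Qed.

Lemma digits_of_gt0 r a b : 0 < r -> digits_of r a b -> 0 < a /\ 0 < b.
Proof.
move=> r0 /digits_of_eq [h1 h2].
have D0 : 0 < k%:Z ^+ 2 - 1 by nia.
split; rewrite -(pmulr_rgt0 _ D0) ?h1 ?h2 mulr_gt0 //; last by lia.
by nia.
Qed.

Lemma digits_of0 : digits_of 0 0 0.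
Proof. by split; rewrite !mulr0. Qed.

Lemma digits_of_scale (i r a b : int) :
  digits_of r a b -> digits_of (i * r) (i * a) (i * b).
Proof.
by case=> h1 h2; split; [rewrite h1; ring | rewrite mulrCA h2; ring].
Qed.

Lemma digits_ofB r a b r' a' b' : digits_of r a b -> digits_of r' a' b' ->
  digits_of (r - r') (a - a') (b - b').
Proof.
by case=> h1 h2 [h3 h4]; split; [rewrite h1 h3; ring | rewrite mulrBr h2 h4; ring].
Qed.

(** Subtracting the solution for [r'], and the one for [r] with its digits swapped, leaves a
    solution of the homogeneous system, which must vanish. *)
Lemma diag_edge_digits r a0 b0 r' a1 b1 c a :
  digits_of r a0 b0 -> digits_of r' a1 b1 ->
  a + r * g%:Z = k%:Z * c + r' -> k%:Z * a + r = c + g%:Z * r' ->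
  c = b1 + a0 /\ a = a1 + b0.
Proof.
move=> [h1 h2] [h3 h4] e1 e2.
have e : digits_of 0 (a - a1 - b0) (c - b1 - a0) by split; lia.
by have [] := digits_of_inj e digits_of0; lia.
Qed.

Lemma edge_diag0_digits r c a :
  edge g k (Pair 0 0) c a (Pair r r) -> digits_of r a c.
Proof. by case/edgeP=> _ _ _ e1 e2; split; lia. Qed.

(** * Admissible values: edges from [Start] and multiples of [r0] *)

Lemma edge_Start_admissible r c a :
  edge g k Start c a (Pair r r) -> admissible g k r.
Proof.
case/edge_StartP=> h a0 c0; apply/admissibleP; exists a, c; split.
- exact: edge_diag0_digits h.
- by case/edgeP: h => _ _ /andP [h _] _ _; lia.
- by case/edgeP: h => _ _ /andP [_ h] _ _; lia.
Qed.

Lemma admissible_edge_Start r :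
  admissible g k r -> exists c a, edge g k Start c a (Pair r r).
Proof.
case/admissibleP=> a [b [h ha hb]]; exists b, a; apply/edge_StartP.
have [r0 rk ba] : [/\ 0 < r, r < k%:Z & b < a] by apply: digits_of_range h _ hb; lia.
split; [|lia|lia]; apply/edgeP; case: h => h1 h2; split=> /=; lia.
Qed.

Lemma admissible_young_node r :
  admissible g k r -> young_node g k (Pair r r).
Proof.
move=> /admissible_edge_Start [c [a e]].
have h : H_node g k (Pair r r) by apply: rt_step; exists c, a.
split=> //; exists (Pair r r); split; last exact: rt_refl.
by left; split=> //; exists r.
Qed.

(** The remainder of [r] modulo [r0] has digits no larger than those of [r]; if positive, it would
    be admissible and below the minimum. *)
Lemma admissible_min_multiple r0 a0 b0 r :
  digits_of r0 a0 b0 -> 0 < r0 -> (forall r, admissible g k r -> r0 <= r) ->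
  admissible g k r -> exists i : nat, r = i%:Z * r0.
Proof.
move=> h0 r0gt0 r0min /admissibleP [a [b [h ha hb]]].
have [rgt0 _ _] : [/\ 0 < r, r < k%:Z & b < a].
  by apply: digits_of_range h _ hb; lia.
have [a0gt0 b0gt0] := digits_of_gt0 r0gt0 h0.
have r0nz : r0 != 0 by lia.
have q0 : 0 <= (r %/ r0)%Z by rewrite divz_ge0 //; lia.
have hrem := digits_ofB h (digits_of_scale (r %/ r0)%Z h0).
have er : r - (r %/ r0)%Z * r0 = (r %% r0)%Z by rewrite {1}(divz_eq r r0) addrC addKr.
rewrite er in hrem.
have rem_ge0 := modz_ge0 r r0nz.
have rem_lt := ltz_pmod r r0gt0.
have rem0 : (r %% r0)%Z = 0.
  apply/eqP; rewrite eq_le rem_ge0 andbT leNgt; apply/negP => rem_gt0.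
  have [ra rb] := digits_of_gt0 rem_gt0 hrem.
  suff /r0min : admissible g k (r %% r0)%Z by lia.
  apply/admissibleP; exists (a - (r %/ r0)%Z * a0), (b - (r %/ r0)%Z * b0).
  by split=> //; nia.
exists `|(r %/ r0)%Z|%N; rewrite gez0_abs //.
by rewrite {1}(divz_eq r r0) rem0 addr0.
Qed.

(** For [i > 0], [i r0] has positive digits [i a0] and [i b0], so only [i a0 < g] limits [i]. The
    assumed count identifies the largest such [i] with [m - 1]. *)
Lemma admissible_multiples m r0 a0 b0 :
  exactly (m - 1)%N (admissible g k) -> digits_of r0 a0 b0 -> 0 < r0 ->
  (forall r, admissible g k r -> r0 <= r) ->
  forall r, admissible g k r <->
    exists i : nat, (1 <= i <= m - 1)%N /\ r = i%:Z * r0.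
Proof.
move=> [s [us ss sP]] h0 r0gt0 r0min.
have [a0gt0 b0gt0] := digits_of_gt0 r0gt0 h0.
pose q := ((g - 1) %/ `|a0|)%N.
have qP r : admissible g k r <-> r \in [seq i%:Z * r0 | i <- iota 1 q].
  split.
    move=> adm; have [i er] := admissible_min_multiple h0 r0gt0 r0min adm.
    apply/mapP; exists i => //; rewrite mem_iota.
    case/admissibleP: adm => a [b [h ha hb]].
    rewrite er in h; have [ea _] := digits_of_inj h (digits_of_scale i%:Z h0).
    have i0 : (0 < i)%N by case: (i) er ea => //; lia.
    rewrite i0 add1n ltnS leq_divRL; last by lia.
    by nia.
  case/mapP=> i; rewrite mem_iota add1n ltnS => /andP [i0]; rewrite leq_divRL; last by lia.
  move=> iq ->; apply/admissibleP; exists (i%:Z * a0), (i%:Z * b0).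
  by split; [exact: digits_of_scale | nia | nia].
have uq : uniq [seq i%:Z * r0 | i <- iota 1 q].
  rewrite map_inj_uniq ?iota_uniq // => i j /(mulIf _) h.
  by have [] : Posz i = Posz j by apply: h; lia.
have eqm : (m - 1)%N = q.
  rewrite -ss -(size_iota 1 q) -(size_map (fun i : nat => i%:Z * r0)).
  apply/eqP; rewrite eqn_leq !uniq_leq_size // => x; first by move/qP/sP.
  by move/sP/qP.
move=> r; rewrite qP eqm; split.
  by case/mapP=> i; rewrite mem_iota add1n ltnS => hi ->; exists i.
by case=> i [hi ->]; apply/mapP; exists i; rewrite ?mem_iota ?add1n ?ltnS.
Qed.

(** * Nodes of a complete Young graph *)

Lemma young_arrow_swap s t r :
  young_arrow g k (Pair r r) (Pair s t) -> young_arrow g k (Pair s t) (Pair r r) ->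
  young_node g k (Pair t s).
Proof.
(* The reversed edges form a path [[r, r] -> [t, s] -> [r, r]], so [[t, s]] reaches the pivot that
   [[r, r]] reaches. *)
move=> [c1 [a1 [[hr [p [pp rp]]] _ /edge_rev e1]]] [c2 [a2 [_ _ /edge_rev e2]]].
split.
  by apply: rt_trans hr _; apply: rt_step; exists a2, c2.
exists p; split=> //; apply: rt_trans rp; apply: rt_step.
by exists a1, c1.
Qed.

Lemma complete_young_node m r0 :
  (2 <= m)%N -> young_is_complete g k m -> 0 < r0 ->
  (forall r, admissible g k r <->
    exists i : nat, (1 <= i <= m - 1)%N /\ r = i%:Z * r0) ->
  forall s r, young_node g k (Pair s r) <->
    exists i : nat, [/\ (i <= m - 1)%N, s = i%:Z * r0 & r = i%:Z * r0].
Proof.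
move=> m2 [_ [S [uS sS SP]] carr cstart] r0gt0 admP.
pose f (i : nat) := (i%:Z * r0, i%:Z * r0).
have finj : injective f.
  by move=> i j [/(mulIf _) h]; have [] : Posz i = Posz j by apply: h; lia.
pose T := [seq f i | i <- iota 1 (m - 1)].
have uT : uniq T by rewrite map_inj_uniq ?iota_uniq.
have sT : size T = (m - 1)%N by rewrite size_map size_iota.
have TS x : x \in T -> x \in S.
  case/mapP=> i; rewrite mem_iota => hi ->; apply/SP; apply: admissible_young_node.
  by apply/admP; exists i; split=> //; lia.
have T_diag r : admissible g k r -> (r, r) \in T.
  by case/admP=> i [hi ->]; apply/mapP; exists i => //; rewrite mem_iota; lia.
(* In [K_m] a nonzero diagonal node receives an edge from [Start], hence is admissible. *)
have diag s : (s, s) \in S -> s <> 0 -> (s, s) \in T.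
  move=> /SP /= hs s0; apply: T_diag.
  by case: (cstart s s hs) => [[]//|c [a [_ _]]] /edge_Start_admissible.
have zero_node : (0, 0) \in S.
  have [x xS xT] : exists2 x, x \in S & x \notin T.
    apply/hasP; apply: contraT; rewrite -all_predC => /allP h.
    have : (size S <= size T)%N.
      by apply: uniq_leq_size => // y /h /=; rewrite negbK.
    by rewrite sS sT; lia.
  case: x xS xT => s t xS xT.
  have [est|st] := eqVneq s t.
    subst t; have [s0|/eqP s0] := eqVneq s 0; first by rewrite s0 in xS.
    by rewrite diag in xT.
  (* Completeness supplies edges both ways between [[s, t]] and [[r0, r0]], so [[t, s]] is a node
     too and [S] would have at least [m + 1] elements. *)
  have d1 : young_node g k (Pair r0 r0).
    by apply: admissible_young_node; apply/admP; exists 1%N; split; lia.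
  have yst : young_node g k (Pair s t) by apply/(SP (s, t)).
  have yts : young_node g k (Pair t s).
    by apply: (@young_arrow_swap _ _ r0); apply: carr.
  have nT u v : u != v -> (u, v) \notin T.
    by move=> uv; apply/mapP => -[i _ [e1 e2]]; rewrite e1 e2 eqxx in uv.
  have : (size ((s, t) :: (t, s) :: T) <= size S)%N.
    apply: uniq_leq_size.
      have ts : t != s by rewrite eq_sym.
      by rewrite /= inE negb_or !nT // uT !andbT xpair_eqE (negPf st).
    move=> y; rewrite !inE => /or3P [/eqP ->|/eqP ->|/TS //]; first exact/SP.
    exact/SP.
  by rewrite /= sS sT; lia.
have zT : f 0%N \notin T.
  by rewrite mem_map // mem_iota.
(* These are [m] distinct members of [S], hence all of it. *)
have [_ eS] : (size (f 0%N :: T) = size S) * (f 0%N :: T =i S).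
  apply: uniq_min_size; rewrite /= ?zT // ?sS ?sT; last by lia.
  move=> x; rewrite inE => /orP [/eqP ->|/TS //].
  by rewrite /f !mul0r.
move=> s r; rewrite -(SP (s, r)) -eS; split.
  rewrite inE => /orP [/eqP [-> ->]|/mapP [i]]; first by exists 0%N; split.
  by rewrite mem_iota => hi [-> ->]; exists i; split=> //; lia.
case=> i [hi -> ->]; rewrite -/(f i) -(map_cons f) mem_map // in_cons mem_iota.
by lia.
Qed.

End YoungGraph.

(** * Reverse multiples as palindromes times [b g + a] *)

Section ReverseMultiples.
Variables g k m a b : nat.
Variable r0 : int.
Hypotheses (k_ge2 : (2 <= k)%N) (k_lt_g : (k < g)%N) (m_ge2 : (2 <= m)%N).
Hypotheses (r0_gt0 : 0 < r0) (ab : digits_of g k r0 a b) (b_gt0 : (0 < b)%N).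
Hypothesis digit_bound : ((m - 1) * (a + b) < g)%N.
Hypothesis young_nodeP : forall s r, young_node g k (Pair s r) <->
  exists i : nat, [/\ (i <= m - 1)%N, s = i%:Z * r0 & r = i%:Z * r0].

(** A palindrome reads the same from either end, so the nonzero head is also the most significant
    digit. *)
Definition leading_palindrome (l : seq nat) : bool :=
  [&& rev l == l, head 0%N l != 0%N & all (fun d => d < m)%N l].

(* The path of length n = size l from Start ends in [0, 0] because the last
   carry vanishes; that end is a pivot, so every node of the path survives in
   the Young graph. *)
Lemma carry_young_node l i :
  all (fun d => d < g)%N l -> last 0%N l != 0%N ->
  (k * lsd_value g l = lsd_value g (rev l))%N -> (1 <= i <= size l)%N ->
  young_node g k (Pair (carry g k 0 l (size l - i))%:Z (carry g k 0 l i)%:Z).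
Proof.
move=> lg lastl e /andP [i1 il].
set n := size l; set R := carry g k 0 l.
have [Rn RS] : R n = 0%N /\ forall j, (j < n)%N ->
    (k * nth 0 l j + R j = nth 0 (rev l) j + g * R j.+1)%N.
  by apply: carryP; rewrite ?size_rev ?all_rev // muln0 !addn0.
have R0 : R 0%N = 0%N by rewrite /R; case: (l).
have Rk j : (R j < k)%N by apply: carry_lt => //; lia.
have dg j : (nth 0 l j < g)%N.
  have [jl|jl] := ltnP j (size l); last by rewrite nth_default //; lia.
  by move/all_nthP: lg; apply.
(* The carries met from the two ends are paired; the carry equations at positions [j] and
   [n - 1 - j] are then the two equations of an edge. *)
pose P j := Pair (R (n - j)%N)%:Z (R j)%:Z.
have PE j : (j < n)%N ->
    edge g k (P j) (nth 0%N l (n - j.+1)) (nth 0%N l j) (P j.+1).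
  move=> jn; apply/(edgeP k_ge2 k_lt_g).
  have [] := (dg j, dg (n - j.+1)%N).
  have := Rk j; have := Rk j.+1; have := Rk (n - j)%N; have := Rk (n - j.+1)%N.
  move=> k1 k2 k3 k4 g1 g2.
  have h1 := RS j jn; have h2 := RS (n - j.+1)%N ltac:(lia).
  rewrite !nth_rev -/n in h1 h2; [|lia|lia].
  have ej : (n - (n - j.+1).+1 = j)%N by lia.
  have ej' : ((n - j.+1).+1 = n - j)%N by lia.
  rewrite ej ej' in h2.
  split=> /=; [lia|lia|lia|lia|lia].
have PStart : arrow g k Start (P 1%N).
  have n0 : (0 < n)%N by lia.
  have := PE 0%N n0; rewrite /P R0 subn0 Rn => h0.
  exists (nth 0%N l (n - 1)), (nth 0%N l 0); apply/edge_StartP => //.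
  (* An edge from [Start] needs nonzero labels: the leading digit is nonzero by hypothesis, and the
     first edge equation makes the trailing digit at least [k] times it. *)
  have hc : (0 < nth 0 l (n - 1))%N by rewrite subn1 nth_last lt0n.
  split; [by []| | by lia].
  by case/(edgeP k_ge2 k_lt_g): h0 => /= _ h _ e1 _; nia.
have reachP u v : (1 <= u)%N -> (u <= v)%N -> (v <= n)%N -> reach g k (P u) (P v).
  move=> u1; elim: v => [|v IH] uv vn; first by lia.
  have [->|uv'] := eqVneq u v.+1; first exact: rt_refl.
  apply: rt_trans (IH _ _) _; [lia|lia|].
  by apply: rt_step; do 2!eexists; apply: PE; lia.
have HP u : (1 <= u)%N -> (u <= n)%N -> H_node g k (P u).
  by move=> u1 un; apply: rt_trans (reachP 1%N u _ _ _) => //; apply: rt_step.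
split; first exact: HP.
exists (P n); split; last by apply: reachP.
left; split; first by apply: HP => //; lia.
by exists 0; rewrite /P subnn R0 Rn.
Qed.

(** The product has exactly one digit more than the palindrome: no carry occurs, and its top digit
    is [b] times a nonzero digit. *)
Lemma revmul_len_palindromeP t N : revmul_len g k t N <->
  exists l, [/\ (size l).+1 = t, leading_palindrome l
              & N = ((b * g + a) * lsd_value g l)%N].
Proof.
have g_gt0 : (0 < g)%N by lia.
rewrite revmul_lenP //; split; last first.
  case=> l [st /and3P [/eqP pl hl lm] ->].
  have ll : last 0%N l != 0%N by rewrite -head_rev pl.
  exists (rev (scaled_digits a b l)); split.
  - by rewrite size_rev size_scaled_digits.
  - rewrite /is_expansion all_rev (scaled_digits_bound lm) //=.
    rewrite numeral_rev lsd_value_scaled eqxx andbT.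
    by rewrite head_rev last_scaled_digits muln_eq0 negb_or ll -lt0n.
  - rewrite numeral_rev rev_scaled_digits pl lsd_value_scaled mulnA.
    by case: ab => h1 h2; congr (_ * _)%N; nia.
case=> ds [st /and3P [dsg hds /eqP eN] e].
set l0 := rev ds.
have l0g : all (fun d => d < g)%N l0 by rewrite all_rev.
have l0last : last 0%N l0 != 0%N.
  by rewrite -head_rev revK.
have el0 : (k * lsd_value g l0 = lsd_value g (rev l0))%N.
  by rewrite -[lsd_value g l0]numeralE -eN e numeral_rev revK.
have sl0 : size l0 = t by rewrite size_rev.
have t0 : (0 < t)%N by rewrite -sl0; case: (l0) l0last.
set R := carry g k 0 l0.
have [Rn RS] : R t = 0%N /\ forall j, (j < t)%N ->
    (k * nth 0 l0 j + R j = nth 0 (rev l0) j + g * R j.+1)%N.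
  by rewrite -sl0; apply: carryP; rewrite ?size_rev ?all_rev // muln0 !addn0.
have R0 : R 0%N = 0%N by rewrite /R; case: (l0).
(* Each carry [R i] turns out to be a multiple of [r0], with quotient [e_ i]. *)
pose e_ i := (R i %/ `|r0|)%N.
have RP i : (i <= t)%N ->
    [/\ (e_ i <= m - 1)%N, R i = (e_ i * `|r0|)%N & R (t - i)%N = R i].
  move=> it; have [i0|i0] := posnP i.
    by rewrite /e_ i0 subn0 Rn R0 div0n.
  have /young_nodeP [j [jm e1 e2]] : young_node g k (Pair (R (t - i)%N)%:Z (R i)%:Z).
    by rewrite -sl0; apply: carry_young_node => //; rewrite i0 sl0.
  have eR : R i = (j * `|r0|)%N by nia.
  by rewrite /e_ eR mulnK; [split=> //; lia|lia].
(* The [i]-th edge joins the diagonal nodes for [e_ i] and [e_ i.+1], which forces its label. *)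
have dig i : (i < t)%N -> nth 0%N l0 i = (e_ i.+1 * a + e_ i * b)%N.
  move=> it.
  have [m1 r1 s1] := RP i (ltnW it); have [m2 r2 s2] := RP i.+1 it.
  have ti : (t - i.+1 < t)%N by lia.
  have h1 := RS i it; have h2 := RS _ ti.
  rewrite nth_rev ?sl0 // in h1; rewrite nth_rev ?sl0 // in h2.
  have ej : (t - (t - i.+1).+1 = i)%N by lia.
  have ej' : ((t - i.+1).+1 = t - i)%N by lia.
  rewrite ej ej' s2 s1 r1 r2 in h2; rewrite r1 r2 in h1.
  have [] := @diag_edge_digits _ _ k_ge2 k_lt_g _ _ _ _ _ _
    (nth 0%N l0 (t - i.+1)) (nth 0%N l0 i) (digits_of_scale (e_ i)%:Z ab)
    (digits_of_scale (e_ i.+1)%:Z ab); [nia | nia | lia].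
have e0 : e_ 0%N = 0%N by rewrite /e_ R0 div0n.
have et : e_ t = 0%N by rewrite /e_ Rn div0n.
(* Both [e_ 0] and [e_ t] vanish, so only the [t - 1] inner quotients serve as digits. *)
pose l := mkseq (fun i => e_ i.+1) (t - 1).
have sl : size l = (t - 1)%N by rewrite size_mkseq.
have el : l0 = scaled_digits a b l.
  apply: (@eq_from_nth _ 0%N); rewrite ?size_scaled_digits sl0 ?sl; first by lia.
  move=> i it; rewrite dig // nth_mkseq ?sl; last by lia.
  congr (_ * _ + _ * _)%N.
    have [it1|it1] := ltnP i (t - 1)%N; first by rewrite nth_mkseq.
    by rewrite nth_default ?sl // -et; congr e_; lia.
  by case: i it => [|i] it //=; rewrite nth_mkseq //; lia.
have pl : rev l = l.
  apply: (@eq_from_nth _ 0%N); rewrite size_rev // sl => i it.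
  rewrite nth_rev sl // !nth_mkseq; [|lia|lia].
  have -> : ((t - 1 - i.+1).+1 = t - i.+1)%N by lia.
  by rewrite /e_; have [_ _ ->] : _ := RP i.+1 ltac:(lia).
exists l; split; first by lia.
  apply/and3P; split; first by apply/eqP.
    by rewrite -pl head_rev; move: l0last; rewrite el last_scaled_digits muln_eq0 negb_or => /andP [].
  by apply/allP => x /mapP [i]; rewrite mem_iota => hi ->; case: (RP i.+1 ltac:(lia)); lia.
by rewrite -lsd_value_scaled -el eN numeralE.
Qed.

(** * Counting reverse multiples of a given length *)

Lemma revmul_len_lt t N : revmul_len g k t N -> (N < g ^ t)%N.
Proof.
rewrite revmul_lenP; last by lia.
case=> ds [<- /and3P [dsg _ /eqP ->] _].
by rewrite numeralE -(size_rev ds) lsd_value_lt // all_rev.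
Qed.

Lemma count_revmulE t (S : seq nat) : uniq S ->
  (forall N, N \in S <-> revmul_len g k t N) -> count_revmul g k t = size S.
Proof.
move=> uS SP; rewrite /count_revmul cardE -(size_map val).
apply/perm_size/uniq_perm => //; first by rewrite map_inj_uniq ?enum_uniq //; exact: val_inj.
move=> N; apply/mapP/idP => [[x]|/SP h].
  by rewrite mem_enum inE => h ->; apply/SP.
by exists (Ordinal (revmul_len_lt h)) => //; rewrite mem_enum inE.
Qed.

Lemma m_le_g : (m <= g)%N.
Proof. by nia. Qed.

Lemma digits_lt_g l : all (fun d => d < m)%N l -> all (fun d => d < g)%N l.
Proof. by apply: sub_all => d; have := m_le_g; lia. Qed.

(* A palindrome of length j.+1 + q, where q is j or j.+1, from its first
   j.+1 digits. *)
Definition mirror (q : nat) (h : seq nat) : seq nat := h ++ rev (take q h).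

(** What remains of [h] after its first [q] entries is at most a single central entry, hence its own
    reverse. *)
Lemma rev_mirror q h : (size h - q <= 1)%N -> rev (mirror q h) = mirror q h.
Proof.
move=> hq; rewrite /mirror rev_cat revK -{2 3}(cat_take_drop q h) rev_cat.
rewrite -catA; congr (_ ++ (_ ++ _)).
by have := size_drop q h; case: (drop q h) => [|x [|y s]] //=; lia.
Qed.

Lemma mirror_take q n l : (q <= n)%N -> size l = (n + q)%N -> rev l = l ->
  mirror q (take n l) = l.
Proof.
move=> qn sl pl; rewrite /mirror take_takel // -{3}(cat_take_drop n l).
by congr (_ ++ _); rewrite -{2}pl drop_rev sl addKn.
Qed.

(** The leading digit is shifted by one to avoid 0 and the others are free, so the cardinality of
    the product type is the count. *)
Definition half_digits (j : nat) (p : 'I_(m - 1) * j.-tuple 'I_m) : seq nat :=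
  (val p.1).+1 :: [seq val d | d <- p.2].

Lemma half_digits_inj j : injective (@half_digits j).
Proof.
move=> [x w] [y v] [exy ewv]; congr (_, _); first exact: val_inj.
by apply: val_inj; apply: (inj_map val_inj).
Qed.

Lemma half_digitsP j h : size h = j.+1 -> head 0%N h != 0%N ->
  all (fun d => d < m)%N h -> exists p, h = @half_digits j p.
Proof.
case: h => [|x h] //= [sh] x0 /andP [xm hm].
have x1 : (x.-1 < m - 1)%N by lia.
have m0 (i : 'I_j) : (nth 0 h i < m)%N by move/all_nthP: hm; apply; rewrite sh.
exists (Ordinal x1, mktuple (fun i => Ordinal (m0 i))).
rewrite /half_digits /= prednK ?lt0n //; congr (_ :: _).
rewrite -map_comp -[LHS](mkseq_nth 0%N) sh /mkseq -val_enum_ord -map_comp.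
exact: eq_map.
Qed.

(** The palindrome has length [j + 1 + q] and is determined by its first [j + 1] digits; [q = j] and
    [q = j + 1] give the products of lengths [2 j + 2] and [2 j + 3]. *)
Lemma count_revmul_palindromes j q : (j <= q <= j.+1)%N ->
  count_revmul g k (j.+1 + q).+1 = ((m - 1) * m ^ j)%N.
Proof.
move=> /andP [jq qj].
have gam0 : (0 < b * g + a)%N by nia.
pose F (p : 'I_(m - 1) * j.-tuple 'I_m) :=
  ((b * g + a) * lsd_value g (mirror q (half_digits p)))%N.
have sh (p : 'I_(m - 1) * j.-tuple 'I_m) : size (half_digits p) = j.+1.
  by rewrite /= size_map size_tuple.
have sm (p : 'I_(m - 1) * j.-tuple 'I_m) :
    size (mirror q (half_digits p)) = (j.+1 + q)%N.
  by rewrite size_cat size_rev sh size_takel // sh.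
have hm (p : 'I_(m - 1) * j.-tuple 'I_m) : all (fun d => d < m)%N (half_digits p).
  rewrite /=; apply/andP; split; first by have := ltn_ord p.1; lia.
  by apply/allP => d /mapP [x _ ->]; exact: ltn_ord.
have mm (p : 'I_(m - 1) * j.-tuple 'I_m) :
    all (fun d => d < m)%N (mirror q (half_digits p)).
  rewrite all_cat hm all_rev; apply/allP => d /mem_take.
  exact: (allP (hm p)).
have Finj : injective F.
  move=> x y /eqP; rewrite eqn_pmul2l // => /eqP /lsd_value_inj e.
  apply: half_digits_inj; have : mirror q (half_digits x) = mirror q (half_digits y).
    by apply: e; rewrite ?sm // digits_lt_g.
  by move/(congr1 (take j.+1)); rewrite !take_cat !sh ltnn subnn !take0 !cats0.
rewrite (@count_revmulE _ [seq F p | p <- enum {: 'I_(m - 1) * j.-tuple 'I_m}]).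
- by rewrite size_map -cardE card_prod card_ord card_tuple card_ord.
- by rewrite map_inj_uniq ?enum_uniq.
move=> N; rewrite revmul_len_palindromeP; split.
  case/mapP=> p _ ->; exists (mirror q (half_digits p)); split=> //; first by rewrite sm.
  by apply/and3P; split=> //; apply/eqP/rev_mirror; rewrite sh; lia.
case=> l [[sl] /and3P [/eqP pl hl lm] ->].
have [p hp] : exists p, take j.+1 l = @half_digits j p.
  apply: half_digitsP.
  - by rewrite size_takel // sl leq_addr.
  - by case: (l) hl.
  - by apply/allP => d /mem_take; exact: (allP lm).
apply/mapP; exists p; rewrite ?mem_enum // /F -hp mirror_take //; lia.
Qed.

Lemma count_revmul_small t : (t < 2)%N -> count_revmul g k t = 0%N.
Proof.
move=> t2; rewrite (@count_revmulE _ [::]) // => N; split=> //.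
case/revmul_len_palindromeP=> l [st /and3P [_ hl _] _].
by case: l st hl => //= x l; lia.
Qed.

Lemma revmul_palindromeP N : revmul g k N <->
  exists beta : nat, [/\ (0 < beta)%N, palindrome_below g m beta
    & N = (numeral g [:: b; a] * beta)%N].
Proof.
have -> : numeral g [:: b; a] = (b * g + a)%N.
  by rewrite numeralE /rev /= !lsd_value_cons /lsd_value big_ord0; lia.
have g_gt0 : (0 < g)%N by lia.
split.
  case=> t /revmul_len_palindromeP [l [_ /and3P [/eqP pl hl lm] ->]].
  have exl : is_expansion g l (lsd_value g l).
    by rewrite /is_expansion digits_lt_g // hl numeralE pl eqxx.
  exists (lsd_value g l); split=> //; first exact: expansion_gt0 exl.
  by exists l.
case=> beta [_ [l [/and3P [_ hl /eqP ebeta] pl lm]] ->].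
exists (size l).+1; apply/revmul_len_palindromeP; exists l; split=> //.
  by rewrite /leading_palindrome pl eqxx hl.
by rewrite ebeta numeralE pl.
Qed.

End ReverseMultiples.

(** * The generating function and the edge labels *)

Lemma geometric_series_is_frac (m : int) (f : series) :
  f 0%N = 0 -> f 1%N = 0 ->
  (forall j : nat, f (2 * j + 2)%N = (m - 1) * m ^+ j /\
                   f (2 * j + 3)%N = (m - 1) * m ^+ j) ->
  series_is_frac f ((m - 1)%:P * 'X^2 * (1 + 'X)) (1 - m%:P * 'X^2).
Proof.
move=> f0 f1 fj.
have pE n : ((m - 1)%:P * 'X^2 * (1 + 'X))`_n = (m - 1) *+ (n \in [:: 2; 3]%N).
  rewrite mulrDr mulr1 -mulrA -exprSr coefD !coefCM !coefXn !inE.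
  by case: eqP => [->|_] /=; [|case: eqP => _]; rewrite ?mulr0 ?mulr1 ?addr0 ?add0r.
have qE n : (1 - m%:P * 'X^2)`_n = (n == 0%N)%:R - m *+ (n == 2)%N.
  by rewrite coefB coef1 coefCM coefXn; case: (n == 2)%N; rewrite ?mulr0 ?mulr1.
split; first by rewrite qE /= subr0 unitr1.
move=> n; rewrite /mul_series /poly_series pE.
case: n => [|[|n]].
- by rewrite big_ord_recl big_ord0 f0 mulr0 addr0.
- by rewrite !big_ord_recl big_ord0 /= f0 f1 !mulr0 !addr0.
(* Only the coefficients of [1] and [X ^ 2] in the denominator survive, leaving
   [f (n + 2) - m f n]. *)
rewrite !big_ord_recl /= big1 => [|i _]; last first.
  by rewrite qE /bump /= !add1n /= subr0 mul0r.
rewrite !qE /bump /= !add1n !subn0 addr0 ?subr0 sub0r mul1r mul0r add0r.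
rewrite !subSS subn0 mulNr.
have [j [en|en]] : exists j, n = (2 * j)%N \/ n = (2 * j).+1.
  by exists n./2; have := odd_double_half n; case: (odd n); lia.
- subst n; have [-> _] : f (2 * j).+2 = (m - 1) * m ^+ j /\ True.
    by have [] := fj j; rewrite addn2.
  (* At [j = 0] the term [m f 0] vanishes and [m - 1] remains, as in the numerator; for larger [j]
     the geometric terms cancel. *)
  case: j => [|j]; first by rewrite /= f0 !mulr0 subr0 mulr1.
  have -> : f (2 * j.+1)%N = (m - 1) * m ^+ j.
    by have [<- _] := fj j; congr f; lia.
  have -> : ((2 * j.+1).+2 \in [:: 2; 3]%N) = false by rewrite !inE; lia.
  by rewrite mulr0n exprS; ring.
subst n; have [_ h] := fj j; rewrite addn3 in h; rewrite h.
case: j {h} => [|j]; first by rewrite /= f1 !mulr0 subr0 mulr1.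
have -> : f (2 * j.+1).+1 = (m - 1) * m ^+ j.
  by have [_ <-] := fj j; congr f; lia.
have -> : ((2 * j.+1).+3 \in [:: 2; 3]%N) = false by rewrite !inE; lia.
by rewrite mulr0n exprS; ring.
Qed.


(** [Start] and [[0, 0]] both have zero coordinates, so a label from either solves the same system,
    whose solution is unique. *)
Lemma diag_edge_label g k r a b u :
  (2 <= k)%N -> (k < g)%N -> digits_of g k r a b ->
  (u = Start \/ u = Pair 0 0) -> young_arrow g k u (Pair r r) ->
  the_edge_label g k u (Pair r r) (digit_b g k r) (digit_a g k r).
Proof.
move=> k_ge2 k_lt_g h hu [c [a' e]].
have lab c1 a1 : young_edge g k u c1 a1 (Pair r r) -> c1 = b /\ a1 = a.
  case=> _ _ e1; suff h1 : digits_of g k r a1 c1.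
    by have [] := digits_of_inj k_ge2 k_lt_g h1 h.
  case: hu e1 => ->; last exact: edge_diag0_digits.
  by case/(edge_StartP k_ge2 k_lt_g) => e1 _ _; exact: edge_diag0_digits e1.
have [ec ea] := lab _ _ e; rewrite {}ec {}ea in e.
have /(digits_ofP k_ge2 k_lt_g) [ea eb] := h.
exists b, a; split=> // c1 a1; split=> [/lab //|[-> ->] //].
Qed.

Theorem theorem6 (g k m : nat) (r0 : int)
  (g_ge3 : (3 <= g)%N) (k_ge2 : (2 <= k)%N) (k_lt_g : (k < g)%N)
  (m_ge2 : (2 <= m)%N)
  (adm_count : exactly (m - 1)%N (admissible g k))
  (complete : young_is_complete g k m)
  (r0_adm : admissible g k r0)
  (r0_min : forall r : int, admissible g k r -> r0 <= r) :
  [/\ (* (i) *)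
      [/\ forall s r : int, young_node g k (Pair s r) <->
            exists i : nat,
              [/\ (i <= m - 1)%N, s = i%:Z * r0 & r = i%:Z * r0],
          forall i : nat, (1 <= i <= m - 1)%N ->
            the_edge_label g k Start (Pair (i%:Z * r0) (i%:Z * r0))
              (digit_b g k (i%:Z * r0)) (digit_a g k (i%:Z * r0))
        & forall i : nat, (i <= m - 1)%N ->
            the_edge_label g k (Pair 0 0) (Pair (i%:Z * r0) (i%:Z * r0))
              (digit_b g k (i%:Z * r0)) (digit_a g k (i%:Z * r0))],
      (* (ii) *)
      [/\ series_is_frac (revmul_gf g k)
            ((m%:Z - 1)%:P * 'X^2 * (1 + 'X)) (1 - m%:Z%:P * 'X^2),
          revmul_gf g k 0%N = 0, revmul_gf g k 1%N = 0
        & forall j : nat,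
            revmul_gf g k (2 * j + 2)%N = (m%:Z - 1) * m%:Z ^+ j /\
            revmul_gf g k (2 * j + 3)%N = (m%:Z - 1) * m%:Z ^+ j]
    & (* (iii) *)
      exists b a : nat,
        [/\ b%:R = digit_b g k r0, a%:R = digit_a g k r0,
            is_expansion g [:: b; a] (numeral g [:: b; a])
          & forall N : nat, revmul g k N <->
              exists beta : nat, [/\ (0 < beta)%N, palindrome_below g m beta
                & N = (numeral g [:: b; a] * beta)%N]]].
Proof.
have /(admissibleP k_ge2 k_lt_g) [a [b [h0 a_range b_gt0]]] := r0_adm.
have [r0_gt0 _ _] : [/\ 0 < r0, r0 < k%:Z & b < a].
  by apply: digits_of_range h0 _ b_gt0 => //; lia.
(* Positivity excludes negative integers; from here on the digits are natural numbers. *)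
case: a b h0 a_range b_gt0 => // a [b|//] h0 a_range b_gt0.
have admP := admissible_multiples k_ge2 k_lt_g adm_count h0 r0_gt0 r0_min.
have nodeP := complete_young_node k_ge2 k_lt_g m_ge2 complete r0_gt0 admP.
have [_ _ carr cstart] := complete.
have node i : (i <= m - 1)%N -> young_node g k (Pair (i%:Z * r0) (i%:Z * r0)).
  by move=> im; apply/nodeP; exists i.
have node0 : young_node g k (Pair 0 0).
  by have := node 0%N isT; rewrite mul0r.
(* Applied to the loop at [[(m - 1) r0, (m - 1) r0]], the label formula gives [(m - 1) (a + b)],
   which must be a digit. *)
have digit_bound : ((m - 1) * (a + b) < g)%N.
  have nm := node _ (leqnn (m - 1)).
  have [c [x [_ _ e]]] := carr _ _ _ _ nm nm.
  case/(edgeP k_ge2 k_lt_g): e => _ _ xb e1 e2.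
  have hm := digits_of_scale (m - 1)%N%:Z h0.
  have [_ ex] := diag_edge_digits k_ge2 k_lt_g hm hm e1 e2.
  by nia.
have count0 t : (t < 2)%N -> count_revmul g k t = 0%N.
  exact: (count_revmul_small k_ge2 k_lt_g m_ge2 r0_gt0 h0 b_gt0 digit_bound nodeP).
have countj j : revmul_gf g k (2 * j + 2)%N = (m%:Z - 1) * m%:Z ^+ j /\
                revmul_gf g k (2 * j + 3)%N = (m%:Z - 1) * m%:Z ^+ j.
  have cnt q : (j <= q <= j.+1)%N ->
      revmul_gf g k (j.+1 + q).+1 = (m%:Z - 1) * m%:Z ^+ j.
    move=> hq; rewrite /revmul_gf.
    rewrite (count_revmul_palindromes k_ge2 k_lt_g m_ge2 r0_gt0 h0 b_gt0 digit_bound nodeP hq).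
    by rewrite PoszM -subzn ?rmorphXn //; lia.
  by split; [rewrite -(cnt j) | rewrite -(cnt j.+1)]; try lia; congr revmul_gf; lia.
have gf0 : revmul_gf g k 0%N = 0 by rewrite /revmul_gf count0.
have gf1 : revmul_gf g k 1%N = 0 by rewrite /revmul_gf count0.
have /(digits_ofP k_ge2 k_lt_g) [ea eb] := h0.
split.
- split=> // i im.
    apply: (diag_edge_label k_ge2 k_lt_g (digits_of_scale i%:Z h0)); first by left.
    apply: cstart; first by apply: node; lia.
    by case=> e; nia.
  apply: (diag_edge_label k_ge2 k_lt_g (digits_of_scale i%:Z h0)); first by right.
  by apply: carr => //; apply: node.
- split=> //; exact: geometric_series_is_frac.
exists b, a; split; rewrite ?eb ?ea //.
- by rewrite /is_expansion /= eqxx; have := digit_bound; nia.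
- exact: (revmul_palindromeP k_ge2 k_lt_g m_ge2 r0_gt0 h0 b_gt0 digit_bound nodeP).
Qed.
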